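(* Let $U$ be a fixed set. An object $\mathcal{H}_C$ of the category $\mathbf{Sset(U)}$ of soft sets over $U$ is a co-separator if and only if there exist $c_1,c_2\in C$ with $c_1\neq c_2$ such that $\mathcal{H}(c_1)=\mathcal{H}(c_2)=U$.
   Context: Let $U$ be a fixed universal set. A soft set $\mathcal{F}_A$ over $U$ consists of a set $A$ (the parameter set, an arbitrary set, possibly empty) together with a function $\mathcal{F}:A\to\mathcal{P}(U)$, where $\mathcal{P}(U)$ is the power set of $U$. A soft morphism from a soft set $\mathcal{F}_A$ to a soft set $\mathcal{G}_B$ is a function $\alpha:A\to B$ such that $\mathcal{F}(a)\subseteq(\mathcal{G}\circ\alpha)(a)$ for each $a\in A$; formally it is regarded as the triple $(\mathcal{F}_A,\alpha,\mathcal{G}_B)$. Composition is composition of functions and the identity soft morphism is the identity function. $\mathbf{Sset(U)}$ is the category whose objects are all soft sets over $U$ and whose morphisms are the soft morphisms. An object $K$ of a category is a co-separator if whenever $f,g:X\to Y$ are distinct morphisms, there exists a morphism $k:Y\to K$ such that $k\circ f\neq k\circ g$. *)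

(* Defs.v *)
From mathcomp Require Import all_boot.
From mathcomp Require Import boolp classical_sets.

Set Implicit Arguments.
Unset Strict Implicit.
Unset Printing Implicit Defensive.

Local Open Scope classical_set_scope.

Record category := Category {
  obj :> Type;
  hom : obj -> obj -> Type;
  idmor : forall X : obj, hom X X;
  compose : forall X Y Z : obj, hom Y Z -> hom X Y -> hom X Z;
  compose_idl : forall (X Y : obj) (f : hom X Y), compose (idmor Y) f = f;
  compose_idr : forall (X Y : obj) (f : hom X Y), compose f (idmor X) = f;
  compose_assoc : forall (W X Y Z : obj)
      (h : hom Y Z) (g : hom X Y) (f : hom W X),
    compose h (compose g f) = compose (compose h g) f
}.

Arguments hom {c} X Y.
Arguments idmor {c} X.
Arguments compose {c X Y Z} g f.

Definition coseparator (C : category) (K : C) : Prop :=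
  forall (X Y : C) (f g : hom X Y), f <> g ->
    exists k : hom Y K, compose k f <> compose k g.

(* Parameter sets are arbitrary types, the empty type included. *)
Record soft_set (U : Type) := SoftSet {
  param : Type;
  soft_map : param -> set U
}.

(* The source and target of the triple (F_A, alpha, G_B) are the indices of
   the type. *)
Record soft_morphism (U : Type) (F G : soft_set U) := SoftMorphism {
  soft_fun :> param F -> param G;
  soft_funP : forall a : param F,
    soft_map a `<=` soft_map (soft_fun a)
}.

Section SoftSetCategory.
Variable U : Type.
Implicit Types F G H : soft_set U.

Lemma soft_morphism_eq F G (f g : soft_morphism F G) :
  soft_fun f = soft_fun g -> f = g.
Proof.
case: f g => [f fP] [g gP] /= fg; case: g / fg gP => gP.
by rewrite (Prop_irrelevance fP gP).
Qed.

Definition soft_id F : soft_morphism F F :=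
  @SoftMorphism U F F id (fun=> @subset_refl U _).

Definition soft_comp F G H (g : soft_morphism G H) (f : soft_morphism F G) :
    soft_morphism F H :=
  @SoftMorphism U F H (fun a => g (f a))
    (fun a => subset_trans (@soft_funP U F G f a) (@soft_funP U G H g (f a))).

Lemma soft_comp_idl F G (f : soft_morphism F G) : soft_comp (soft_id G) f = f.
Proof. exact: soft_morphism_eq. Qed.

Lemma soft_comp_idr F G (f : soft_morphism F G) : soft_comp f (soft_id F) = f.
Proof. exact: soft_morphism_eq. Qed.

Lemma soft_comp_assoc E F G H (h : soft_morphism G H) (g : soft_morphism F G)
    (f : soft_morphism E F) :
  soft_comp h (soft_comp g f) = soft_comp (soft_comp h g) f.
Proof. exact: soft_morphism_eq. Qed.

Definition Sset : category :=
  Category soft_comp_idl soft_comp_idr soft_comp_assoc.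

End SoftSetCategory.

(* Main.v *)
(** If [H] is a co-separator, distinguish the two points of the two-element
    soft set with constant value [U]: their images in [H] are distinct and have
    value [U].  Conversely, every function into the parameters of [H] with
    values in [{c1, c2}] is a soft morphism, so soft morphisms to [H] separate
    the points of any soft set. *)
Require Import Defs.
From mathcomp Require Import all_boot.
From mathcomp Require Import boolp classical_sets.

Local Open Scope classical_set_scope.

Definition full_soft_set (U T : Type) : soft_set U :=
  @SoftSet U T (fun=> [set: U]).

(** The value [set0] makes the inclusion condition vacuous, so soft morphisms from this object to
    [G] amount to parameters of [G]. *)
Definition empty_soft_point (U : Type) : soft_set U :=
  @SoftSet U unit (fun=> set0).

Definition soft_point {U : Type} {G : soft_set U} (b : param G) :
    soft_morphism (empty_soft_point U) G :=
  @SoftMorphism U (empty_soft_point U) G (fun=> b) (fun=> @sub0set U _).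

Lemma soft_map_full {U T : Type} {H : soft_set U}
    (k : soft_morphism (full_soft_set U T) H) (t : T) :
  soft_map (k t) = [set: U].
Proof. by rewrite -subTset; exact: (@soft_funP _ _ _ k t). Qed.

Lemma soft_morphism_neq {U : Type} {F G : soft_set U}
    {f g : soft_morphism F G} : f <> g -> exists a, f a <> g a.
Proof.
move=> fg; apply: contrapT => /forallNP fgE; apply/fg/soft_morphism_eq/funext.
by move=> a; apply: contrapT; exact: fgE.
Qed.

Definition soft_indicator {U : Type} {G H : soft_set U} {c1 c2 : param H}
    (c1U : soft_map c1 = [set: U]) (c2U : soft_map c2 = [set: U])
    (B : set (param G)) : soft_morphism G H.
Proof.
exists (fun b => if `[< B b >] then c1 else c2) => b.
by case: ifP => _; rewrite ?c1U ?c2U; exact: subsetT.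
Defined.

Theorem theorem5 (U : Type) (H : Sset U) :
  coseparator H <->
  exists c1 c2 : param H,
    [/\ c1 <> c2, soft_map c1 = [set: U] & soft_map c2 = [set: U]].
Proof.
split=> [sepH | [c1 [c2 [c12 c1U c2U]]] F G f g /soft_morphism_neq [a fga]].
  pose x (b : bool) : hom (empty_soft_point U : Sset U)
    (full_soft_set U bool : Sset U) :=
    @soft_point U (full_soft_set U bool) b.
  have [|k kx] := sepH _ _ (x true) (x false).
    by move=> /(congr1 (fun h : soft_morphism (empty_soft_point U)
      (full_soft_set U bool) => h tt)).
  exists (soft_fun k true), (soft_fun k false).
  split; [|exact: soft_map_full..].
  (* If [k] identified [true] and [false], its composites with the two points would coincide,
     against [kx]. *)
  by move=> kE; apply/kx/soft_morphism_eq/funext.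
(* The indicator of the singleton of [f a] sends [f a] to [c1] and [g a], which differs from it, to
   [c2]. *)
exists (soft_indicator c1U c2U [set f a]).
move=> /(congr1 (fun h : soft_morphism F H => h a)) /=.
by rewrite asboolT // asboolF // => gaE; apply: fga.
Qed.
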